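(* Let $\Omega\subset\mathbb{C}^n$ be a bounded domain and let $f:\Omega\to\mathbb{C}$ be a non-constant holomorphic function. Suppose there exists a sequence of points $z_j\in\Omega$ with $f^\sharp(z_j)>0$ such that $\rho_j:=1/f^\sharp(z_j)\to 0$ as $j\to\infty$, and such that the sequence $$g_j(\zeta)=f(z_j+\rho_j\zeta)$$ converges locally uniformly in $\mathbb{C}^n$ to a non-constant entire function $g:\mathbb{C}^n\to\mathbb{C}$ satisfying $g^\sharp(\zeta)\le g^\sharp(0)=1$ for all $\zeta\in\mathbb{C}^n$. Then $f$ is not normal on $\Omega$.
   Context: Let $D$ be a domain in $\mathbb{C}^n$. For a real-valued $C^2$ function $\varphi$ on $D$, a point $z\in D$ and $v\in\mathbb{C}^n$, the Levi form is $$L_z(\varphi,v):=\sum_{k,l=1}^n\frac{\partial^2\varphi}{\partial z_k\,\partial\overline{z}_l}(z)\,v_k\overline{v}_l.$$ For a holomorphic function $h:D\to\mathbb{C}$ (with $D=\Omega$, or $D=\mathbb{C}^n$ for entire functions) set $$h^\sharp(z):=\sup_{|v|=1}\sqrt{L_z(\log(1+|h|^2),v)},$$ where $|\cdot|$ is the Euclidean norm on $\mathbb{C}^n$; the Levi form here is nonnegative. Let $U$ be the open unit disk in $\mathbb{C}$. The infinitesimal Kobayashi metric of a bounded domain $\Omega\subset\mathbb{C}^n$ is $$K_\Omega(z,v)=\inf\{\alpha>0:\ \exists\, \phi:U\to\Omega \text{ holomorphic with } \phi(0)=z,\ \phi'(0)=v/\alpha\},\qquad (z,v)\in\Omega\times\mathbb{C}^n.$$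 A holomorphic function $f:\Omega\to\mathbb{C}$ is called normal if there is a constant $C$, $0<C<\infty$, such that $$L_z(\log(1+|f|^2),v)\le C\cdot K_\Omega(z,v)^2\quad\text{for all }(z,v)\in\Omega\times\mathbb{C}^n.$$ The functions $g_j$ are defined on $\{\zeta\in\mathbb{C}^n: z_j+\rho_j\zeta\in\Omega\}$. Locally uniform convergence of $g_j$ to $g$ in $\mathbb{C}^n$ means: for every compact set $E\subset\mathbb{C}^n$, $g_j$ is defined on $E$ for all sufficiently large $j$ and $g_j\to g$ uniformly on $E$. *)

(* Defs.v *)
From HB Require Import structures.
From mathcomp Require Import all_boot all_order all_algebra.
From mathcomp Require Import all_classical all_reals all_analysis.
From mathcomp Require Import complex.

Set Implicit Arguments.
Unset Strict Implicit.
Unset Printing Implicit Defensive.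

Import Order.TTheory GRing.Theory Num.Theory.
Import numFieldNormedType.Exports.

Local Open Scope classical_set_scope.
Local Open Scope ring_scope.
Local Open Scope complex_scope.

(* R[i] gets the norm topology, the one of the regular module K^o of any
   numFieldType K.  C^n is ['rV[R[i]]_n]: its normed-module structure is
   given by the max-norm, which has the same open sets, bounded sets and
   differentiable maps as the Euclidean norm [enorm] below. *)
HB.instance Definition _ (R : realType) :=
  PseudoPointedMetric.copy R[i] R[i]^o.
HB.instance Definition _ (R : realType) := NormedModule.copy R[i] R[i]^o.

Section SeveralComplexVariables.
Variable R : realType.

(* [differentiable] is Frechet differentiability over the base field of the
   normed modules, here R[i], so this is complex differentiability. *)
Definition holomorphic (V W : normedModType R[i]) (D : set V) (f : V -> W) :=
  forall x, D x -> differentiable f x.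

Definition nonconstant (V W : Type) (D : set V) (f : V -> W) :=
  exists x y, [/\ D x, D y & f x <> f y].

Variable n : nat.
Implicit Types (D : set 'rV[R[i]]_n) (z u v : 'rV[R[i]]_n).

Definition domain D := [/\ open D, connected D & D !=set0].

Definition enorm v : R :=
  Num.sqrt (\sum_i (complex.Re (v 0 i) ^+ 2 + complex.Im (v 0 i) ^+ 2)).

Definition real_derive (F : 'rV[R[i]]_n -> R[i]) u z : R[i] :=
  derive1 (fun t : R => complex.Re (F (z + t%:C *: u))) 0
    +i* derive1 (fun t : R => complex.Im (F (z + t%:C *: u))) 0.

Let e_ (k : 'I_n) : 'rV[R[i]]_n := delta_mx 0 k.

(* d/dz_k = (d/dx_k - i d/dy_k) / 2 and d/dzbar_k = (d/dx_k + i d/dy_k) / 2,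
   where z_k = x_k + i y_k. *)
Definition dz (k : 'I_n) (F : 'rV[R[i]]_n -> R[i]) z : R[i] :=
  (real_derive F (e_ k) z - 'i * real_derive F ('i *: e_ k) z) / 2%:R.

Definition dzbar (k : 'I_n) (F : 'rV[R[i]]_n -> R[i]) z : R[i] :=
  (real_derive F (e_ k) z + 'i * real_derive F ('i *: e_ k) z) / 2%:R.

(* The sum is a real number when phi is C^2, by the symmetry of the second
   derivatives; [Re] only brings it back to the type R. *)
Definition levi (phi : 'rV[R[i]]_n -> R) z v : R :=
  complex.Re (\sum_k \sum_l
    dz k (dzbar l (fun x => (phi x)%:C)) z * v 0 k * (v 0 l)^*).

Definition log1p_sqnorm (h : 'rV[R[i]]_n -> R[i]) (z : 'rV[R[i]]_n) : R :=
  ln (1 + complex.Re `|h z| ^+ 2).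

(* [h] only matters near [z]. When [h] is holomorphic near [z] and [n > 0], the
   set is nonempty and bounded, so [sup] is the true supremum. *)
Definition sharp (h : 'rV[R[i]]_n -> R[i]) z : R :=
  sup [set Num.sqrt (levi (log1p_sqnorm h) z v) | v in [set v | enorm v = 1]].

Definition unit_disk : set R[i] := [set w | `|w| < 1].

(* For [Omega] open and [z] in [Omega] this set is nonempty (small affine disks)
   and bounded below by 0, so the real-valued [inf] is the true infimum. *)
Definition kobayashi (Omega : set 'rV[R[i]]_n) z v : R :=
  inf [set alpha : R | 0 < alpha /\
    exists phi : R[i] -> 'rV[R[i]]_n,
      [/\ holomorphic unit_disk phi, phi @` unit_disk `<=` Omega,
          phi 0 = z & derive1 phi 0 = (alpha^-1)%:C *: v]].

(* [f] is meant to be holomorphic on [Omega]. *)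
Definition normal_function (Omega : set 'rV[R[i]]_n) (f : 'rV[R[i]]_n -> R[i]) :=
  exists2 C : R, 0 < C & forall z v, Omega z ->
    levi (log1p_sqnorm f) z v <= C * kobayashi Omega z v ^+ 2.

(* g_ j is only meaningful on D_ j. *)
Definition locally_uniform_cvg (D_ : nat -> set 'rV[R[i]]_n)
    (g_ : nat -> 'rV[R[i]]_n -> R[i]) (g : 'rV[R[i]]_n -> R[i]) :=
  forall E : set 'rV[R[i]]_n, compact E ->
    (\forall j \near \oo, E `<=` D_ j) /\ {uniform E, g_ @ \oo --> g}.

End SeveralComplexVariables.

(* Main.v *)
(** If [r] is any radius, then for large [j] the map [g_ j] is defined on a
    fixed compact set containing the ball of radius [r], so the affine disks
    of radius [rho j * r] centred at [z j] lie in [Omega], whence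
    K(z_j, v) <= 1 / (rho_j r) for every unit vector [v].  Normality with
    constant [C] then gives f#(z_j) <= sqrt C / (rho_j r) = (sqrt C / r) f#(z_j),
    which is absurd once r > sqrt C. *)

Require Import Defs.
From mathcomp Require Import all_boot all_order all_algebra.
From mathcomp Require Import all_classical all_reals all_analysis.
From mathcomp Require Import complex.
Import Order.TTheory GRing.Theory Num.Theory.
Import numFieldNormedType.Exports.
Local Open Scope classical_set_scope.
Local Open Scope ring_scope.
Local Open Scope complex_scope.

Lemma continuous_real_complex (R : realType) :
  continuous (real_complex R : R -> R[i]).
Proof.
move=> x; apply/cvgrPdist_lt => /= e; rewrite ltcE /= => /andP[/eqP ime e0].
(* Positivity in [R[i]] forces a zero imaginary part, so the tolerance [e] is a real number. *)
have eE : e = (complex.Re e)%:C by case: e ime e0 => a b /= ->.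
near=> t; rewrite -rmorphB normc_def /= expr0n addr0 sqrtr_sqr eE ltcR.
by near: t; apply: cvgr_dist_lt.
Unshelve. all: by end_near.
Qed.

Lemma compact_csquare (R : realType) (r : R) :
  compact [set w : R[i] | `|complex.Re w| <= r /\ `|complex.Im w| <= r].
Proof.
rewrite (_ : [set _ | _] =
  (fun p : R * R => p.1%:C + 'i * p.2%:C) @` (`[- r, r] `*` `[- r, r])).
  apply: continuous_compact; last first.
    by apply: compact_setX; exact: segment_compact.
  apply: continuous_subspaceT => p; apply: cvgD.
    by apply: continuous_comp; [exact: cvg_fst|exact: continuous_real_complex].
  apply: cvgM; first exact: cvg_cst.
  by apply: continuous_comp; [exact: cvg_snd|exact: continuous_real_complex].
apply/seteqP; split=> [[a b] /= [ar br]|_ [[a b] /= [ar br] <-]].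
  by exists (a, b); rewrite /= ?in_itv /= -?ler_norml //; simpc.
by simpc; move: ar br; rewrite /= !in_itv /= -!ler_norml.
Qed.

(** This box replaces the closed Euclidean ball of radius [r], which it contains: its compactness
    follows coordinate by coordinate. *)
Lemma compact_cpolysquare (R : realType) (n : nat) (r : R) :
  compact [set v : 'rV[R[i]]_n | forall i,
    `|complex.Re (v 0 i)| <= r /\ `|complex.Im (v 0 i)| <= r].
Proof. exact: (rV_compact (fun=> @compact_csquare R r)). Qed.

Lemma norm_coord_le_enorm (R : realType) (n : nat) (v : 'rV[R[i]]_n) (i : 'I_n) :
  `|v 0 i| <= (enorm v)%:C.
Proof.
rewrite normc_def lecR ler_wsqrtr // (bigD1 i) //= lerDl.
by apply: sumr_ge0 => k _; rewrite addr_ge0 ?sqr_ge0.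
Qed.

Lemma normc_ReIm_le (R : rcfType) (w : R[i]) (r : R) : `|w| <= r%:C ->
  `|complex.Re w| <= r /\ `|complex.Im w| <= r.
Proof.
rewrite normc_def lecR => wr; split; apply: le_trans wr;
  by rewrite -sqrtr_sqr ler_wsqrtr // ?lerDl ?lerDr sqr_ge0.
Qed.

Lemma kobayashi_ge0 (R : realType) (n : nat) (Omega : set 'rV[R[i]]_n)
  (z v : 'rV[R[i]]_n) : 0 <= kobayashi Omega z v.
Proof.
rewrite /kobayashi; set A := [set _ | _].
(* [Omega] and [z] are arbitrary here, so there may be no competing disk; [inf] is then 0 by
   convention. *)
have [->|/set0P A0] := eqVneq A set0; first by rewrite inf0.
by apply: lb_le_inf => // x [/ltW].
Qed.

(** The affine disk [w] ↦ [z + s w v] competes in the infimum: its derivative at 0 is [s v], which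
    corresponds to [alpha = s^-1]. *)
Lemma kobayashi_le_affine_disk (R : realType) (n : nat)
  (Omega : set 'rV[R[i]]_n) (z v : 'rV[R[i]]_n) (s : R) : 0 < s ->
  (forall w : R[i], `|w| < 1 -> Omega (z + s%:C *: (w *: v))) ->
  kobayashi Omega z v <= s^-1.
Proof.
move=> s0 disk; apply: ge_inf; first by exists 0 => x [/ltW].
split; first by rewrite invr_gt0.
pose phi (w : R[i]) := z + s%:C *: (w *: v).
have phi_diff (w : R[i]) : is_diff w phi (0 + *:%R ^~ (s%:C *: v)).
  rewrite (_ : phi = cst z + *:%R ^~ (s%:C *: v)); first exact: is_diffD.
  by apply/funext => t; rewrite /phi fctE /= !scalerA mulrC.
exists phi; split.
- by move=> w _; case: (phi_diff w).
- by move=> _ [w w1 <-]; exact: disk.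
- by rewrite /phi scale0r scaler0 addr0.
- rewrite derive1E' ?invrK; last by case: (phi_diff 0).
  by case: (phi_diff 0) => _ -> /=; rewrite fctE add0r scale1r.
Qed.

Theorem theorem0p2 (R : realType) (n : nat)
  (Omega : set 'rV[R[i]]_n) (f : 'rV[R[i]]_n -> R[i])
  (Omega_domain : domain Omega)
  (Omega_bounded : bounded_set Omega)
  (f_holo : holomorphic Omega f)
  (f_nonconst : nonconstant Omega f)
  (z : nat -> 'rV[R[i]]_n) (rho : nat -> R) (g : 'rV[R[i]]_n -> R[i])
  (z_in : forall j, Omega (z j))
  (sharp_gt0 : forall j, 0 < sharp f (z j))
  (rhoE : forall j, rho j = 1 / sharp f (z j))
  (rho_cvg0 : rho @ \oo --> (0 : R))
  (g_cvg : locally_uniform_cvg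
     (fun j => [set zeta | Omega (z j + (rho j)%:C *: zeta)])
     (fun j zeta => f (z j + (rho j)%:C *: zeta)) g)
  (g_entire : holomorphic setT g)
  (g_nonconst : nonconstant setT g)
  (g_sharp_le : forall zeta, sharp g zeta <= sharp g 0)
  (g_sharp0 : sharp g 0 = 1) :
  ~ normal_function Omega f.
Proof.
move=> [C C0 f_normal].
(* Any radius strictly above [Num.sqrt C] would do; the strict excess yields the final
   contradiction. *)
pose r := Num.sqrt C + 1.
have r0 : 0 < r by rewrite ltr_wpDl ?sqrtr_ge0.
have [[j _ /(_ j (leqnn j)) polyO] _] := g_cvg _ (compact_cpolysquare R n r).
have rho0 : 0 < rho j by rewrite rhoE div1r invr_gt0.
have sr0 : 0 < rho j * r by rewrite mulr_gt0.
have kob v : enorm v = 1 -> kobayashi Omega (z j) v <= (rho j * r)^-1.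
  move=> v1; apply: kobayashi_le_affine_disk => // w w1.
  (* The point [r w v] lies in the box, each coordinate having modulus [r |w| |v_i| <= r]. *)
  rewrite rmorphM -scalerA; apply: polyO => i; rewrite !mxE.
  apply: normc_ReIm_le; rewrite !normrM.
  have -> : `|r%:C| = r%:C by rewrite ger0_norm // lecR ltW.
  apply: ler_piMr; first by rewrite lecR ltW.
  apply: mulr_ile1; rewrite ?normr_ge0 ?(ltW w1) //.
  by have := norm_coord_le_enorm _ _ v i; rewrite v1.
have : sharp f (z j) <= Num.sqrt C * (rho j * r)^-1.
  (* Without unit vectors ([n = 0]) the supremum is 0 by convention, contrary to [sharp_gt0]. *)
  have [E0|] := eqVneq [set Num.sqrt (levi (log1p_sqnorm f) (z j) v)
                         | v in [set v | enorm v = 1]] set0.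
    by have := sharp_gt0 j; rewrite /sharp E0 sup0 ltxx.
  move=> /set0P ne; apply: ge_sup => // _ [v v1 <-].
  apply: (@le_trans _ _ (Num.sqrt (C * kobayashi Omega (z j) v ^+ 2))).
    by rewrite ler_wsqrtr // f_normal.
  rewrite sqrtrM ?(ltW C0) // sqrtr_sqr ger0_norm ?kobayashi_ge0 //.
  by rewrite ler_wpM2l ?sqrtr_ge0 // kob.
(* Since [sharp f (z j) * rho j = 1], the negated bound reduces to [Num.sqrt C < r]. *)
apply/negP; rewrite -ltNge ltr_pdivrMr // mulrA rhoE div1r mulfV ?gt_eqF //.
by rewrite mul1r ltrDl.
Qed.
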